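(* Let $F$ be a hyperfield with a valuation $v$ and an ordering $P$. The following conditions are equivalent: (i) $A(P)\subseteq\mathcal O_v$; (ii) $\overline P:=\{a+\mathcal M_v\mid a\in P\cap\mathcal O_v^\times\}$ is an ordering of the residue hyperfield $\mathcal O_v/\mathcal M_v$; (iii) $1+\mathcal M_v\subseteq P$; (iv) for all $a,b\in F$: if $(b+a)\cap P\neq\emptyset$ and $(b-a)\cap P\neq\emptyset$, then $v(a)\ge v(b)$.
   Context: A hyperoperation $+$ on a nonempty set $H$ assigns to each $(x,y)\in H\times H$ a nonempty subset $x+y\subseteq H$; for subsets, $A+B=\bigcup_{a\in A,b\in B}(a+b)$, and elements are identified with singletons. A canonical hypergroup is $(H,+,0)$ with $+$ an associative and commutative hyperoperation such that for every $x$ there is a unique $-x$ with $0\in x+(-x)$, and $z\in x+y$ implies $y\in z-x:=z+(-x)$. A hyperring is $(R,+,\cdot,0)$ with $(R,+,0)$ a canonical hypergroup, $(R,\cdot)$ a commutative semigroup with $x\cdot 0=0$, and $x(y+z)=xy+xz$ as sets. A hyperfield is a hyperring $F$ with unity $1\neq 0$ such that $F^\times=F\setminus\{0\}$ is a group under multiplication. An ordering of a hyperfield $F$ is a subset $P\subseteq F$ with $P+P\subseteq P$, $P\cdot P\subseteq P$, $P\cap -P=\emptyset$, $P\cup -P=F^\times$. For $n\in\mathbb N$ ($n\ge 1$), $I_n:=1+\dots+1$ ($n$ summands), a subset of $F$, and $$A(P):=\{a\in F\mid \text{there is } n\in\mathbb N \text{ with } (I_n+a)\cap P\ne\emptyset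 \text{ and } (I_n-a)\cap P\neq\emptyset\}.$$ A valuation on $F$ is a map $v:F\to\Gamma\cup\{\infty\}$, $\Gamma$ a (linearly) ordered abelian group written additively, with: $v(a)=\infty$ iff $a=0$; $v(ab)=v(a)+v(b)$; $c\in a+b\Rightarrow v(c)\ge\min\{v(a),v(b)\}$. Put $\mathcal O_v=\{x: v(x)\ge 0\}$, $\mathcal M_v=\{x: v(x)>0\}$, $\mathcal O_v^\times=\{x: v(x)=0\}$. The residue hyperfield $\mathcal O_v/\mathcal M_v$ consists of the classes $x+\mathcal M_v$ ($x\in\mathcal O_v$) of the equivalence relation $x\sim y\iff (x-y)\cap\mathcal M_v\ne\emptyset$, with $(x+\mathcal M_v)+(y+\mathcal M_v)=\{z+\mathcal M_v: z\in x+y\}$ and $(x+\mathcal M_v)(y+\mathcal M_v)=xy+\mathcal M_v$. *)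

(* Defs.v *)
From HB Require Import structures.
From mathcomp Require Import all_boot all_order all_algebra.
From mathcomp Require Import boolp classical_sets.

Set Implicit Arguments.
Unset Strict Implicit.
Unset Printing Implicit Defensive.

Import Order.TTheory GRing.Theory.

Declare Scope hyper_scope.
Delimit Scope hyper_scope with H.
Local Open Scope classical_set_scope.
Local Open Scope hyper_scope.

Definition hset_op {T : Type} (op : T -> T -> set T) (A B : set T) : set T :=
  \bigcup_(a in A) \bigcup_(b in B) op a b.

(* [hopp_uniq] makes [hopp] determined by [hadd] and [hzero]. *)
HB.mixin Record isCanonicalHypergroup (H : Type) := {
  hzero : H;
  hopp : H -> H;
  hadd : H -> H -> set H;
  hadd_nonempty : forall x y, hadd x y !=set0;
  haddA : forall x y z,
    hset_op hadd [set x] (hadd y z) = hset_op hadd (hadd x y) [set z];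
  haddC : forall x y, hadd x y = hadd y x;
  haddN : forall x, hadd x (hopp x) hzero;
  hopp_uniq : forall x y, hadd x y hzero -> y = hopp x;
  hadd_rev : forall x y z, hadd x y z -> hadd z (hopp x) y
}.

#[short(type="canonicalHypergroupType")]
HB.structure Definition CanonicalHypergroup := {H of isCanonicalHypergroup H}.

Arguments hadd_rev {_} [x y z] _.
Arguments hopp_uniq {_} [x y] _.

Notation "x ⊞ y" := (hadd x y)
  (at level 50, left associativity) : hyper_scope.
Notation "⊟ x" := (hopp x) (at level 35, right associativity) : hyper_scope.
Notation "A ⊕ B" := (hset_op hadd A B)
  (at level 50, left associativity) : hyper_scope.

HB.mixin Record CanonicalHypergroup_isHyperring (R : Type)
    of CanonicalHypergroup R := {
  hmul : R -> R -> R;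
  hmulA : forall x y z : R, hmul x (hmul y z) = hmul (hmul x y) z;
  hmulC : forall x y : R, hmul x y = hmul y x;
  hmul0 : forall x : R, hmul x hzero = hzero;
  hmulDr : forall x y z : R,
    [set hmul x w | w in y ⊞ z] = hmul x y ⊞ hmul x z
}.

#[short(type="hyperringType")]
HB.structure Definition Hyperring :=
  {R of CanonicalHypergroup R & CanonicalHypergroup_isHyperring R}.

Notation "x ⊙ y" := (hmul x y)
  (at level 40, left associativity) : hyper_scope.

(* Closure of the nonzero elements under product is a consequence:
   see [hmul_neq0]. *)
HB.mixin Record Hyperring_isHyperfield (F : Type) of Hyperring F := {
  hone : F;
  hmul1 : forall x : F, x ⊙ hone = x;
  hone_neq0 : hone <> hzero;
  hmulV : forall x : F, x <> hzero -> exists y : F, x ⊙ y = hone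
}.

#[short(type="hyperfieldType")]
HB.structure Definition Hyperfield :=
  {F of Hyperring F & Hyperring_isHyperfield F}.

HB.mixin Record POrderedZmodule_isOrderedAbGroup G
    of Num.POrderedZmodule G := {
  oag_le_total : forall x y : G, (x <= y)%R || (y <= x)%R;
  oag_le_add2l : forall z x y : G, (x <= y)%R -> (z + x <= z + y)%R
}.

#[short(type="orderedAbGroupType")]
HB.structure Definition OrderedAbGroup :=
  {G of Num.POrderedZmodule G & POrderedZmodule_isOrderedAbGroup G}.

(* [None] is infinity. *)
Definition with_infty (G : Type) : Type := option G.
Definition infty {G : Type} : with_infty G := None.
Definition fin {G : Type} (x : G) : with_infty G := Some x.

Section WithInfty.
Variable G : orderedAbGroupType.
Implicit Types x y z : with_infty G.
Local Open Scope ring_scope.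

HB.instance Definition _ := Choice.on (with_infty G).

Definition wi_le x y : bool :=
  match x, y with
  | _, None => true
  | None, Some _ => false
  | Some a, Some b => a <= b
  end.

Definition wi_add x y : with_infty G :=
  match x, y with
  | Some a, Some b => Some (a + b)
  | _, _ => None
  end.

Fact wi_le_anti : antisymmetric wi_le.
Proof. by case=> [a|] [b|] //= /le_anti ->. Qed.

Fact wi_le_trans : transitive wi_le.
Proof. by case=> [a|] [b|] [c|] //=; apply: le_trans. Qed.

Fact wi_le_total : total wi_le.
Proof. by case=> [a|] [b|] //=; apply: oag_le_total. Qed.

HB.instance Definition _ := @Order.isOrder.Build ring_display (with_infty G)
  wi_le _ _ _ (fun _ _ => erefl) (fun _ _ => erefl) (fun _ _ => erefl)
  wi_le_anti wi_le_trans wi_le_total.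

End WithInfty.

Record is_ordering (F : hyperfieldType) (P : set F) : Prop := IsOrdering {
  ordering_add : P ⊕ P `<=` P;
  ordering_mul : [set x ⊙ y | x in P & y in P] `<=` P;
  ordering_disj : P `&` [set ⊟ x | x in P] = set0;
  ordering_cover : P `|` [set ⊟ x | x in P] = [set x | x <> hzero]
}.

(* 1 + ... + 1 with [n] summands; only meaningful for [n >= 1]. *)
Definition hone_sum (F : hyperfieldType) (n : nat) : set F :=
  iter n.-1 (fun A => A ⊕ [set hone]) [set hone].
Arguments hone_sum F n : clear implicits.

Definition bounded_elements (F : hyperfieldType) (P : set F) : set F :=
  [set a | exists n : nat,
     [/\ (1 <= n)%N, (hone_sum F n ⊕ [set a]) `&` P !=set0
       & (hone_sum F n ⊕ [set ⊟ a]) `&` P !=set0]].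

Record valuation (F : hyperfieldType) (G : orderedAbGroupType) := Valuation {
  val_fun :> F -> with_infty G;
  val_infty : forall a, val_fun a = infty <-> a = hzero;
  val_mul : forall a b, val_fun (a ⊙ b) = wi_add (val_fun a) (val_fun b);
  val_add : forall a b c,
    (a ⊞ b) c -> (Order.min (val_fun a) (val_fun b) <= val_fun c)%R
}.

Section ValuationSets.
Variables (F : hyperfieldType) (G : orderedAbGroupType) (v : valuation F G).

Definition val_ring : set F := [set x | (fin 0 <= v x)%R].
Definition val_ideal : set F := [set x | (fin 0 < v x)%R].
Definition val_units : set F := [set x | v x = fin 0%R].

Definition residue_rel (x y : F) : Prop :=
  (x ⊞ ⊟ y) `&` val_ideal !=set0.

(* The class [x + val_ideal]; see [residue_classE]. *)
Definition residue_class (x : F) : set F :=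
  [set y | val_ring y /\ residue_rel x y].

Definition residue : Type :=
  {C : set F | exists2 x, val_ring x & C = residue_class x}.

End ValuationSets.

Section HypergroupTheory.
Variable H : canonicalHypergroupType.
Implicit Types (x y z : H) (A B C : set H).

Lemma hset_opP A B z :
  (A ⊕ B) z <-> exists x y, [/\ A x, B y & (x ⊞ y) z].
Proof.
split=> [[x Ax [y By xyz]]|[x [y [Ax By xyz]]]]; first by exists x, y.
by exists x => //; exists y.
Qed.

Lemma hset_op11 x y : [set x] ⊕ [set y] = x ⊞ y.
Proof. by rewrite /hset_op !bigcup_set1. Qed.

Lemma hset_opC A B : A ⊕ B = B ⊕ A.
Proof.
apply/seteqP; split=> z /hset_opP[x [y [Ax By xyz]]]; apply/hset_opP;
by exists y, x; split=> //; rewrite haddC.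
Qed.

Lemma hset_opA A B C : A ⊕ (B ⊕ C) = A ⊕ B ⊕ C.
Proof.
apply/seteqP; split=> z /hset_opP[x [y []]].
- move=> Ax /hset_opP[b [c [Bb Cc bcy]]] xyz.
  have : ([set x] ⊕ (b ⊞ c)) z by apply/hset_opP; exists x, y.
  rewrite haddA => /hset_opP[u [_ [xbu /= -> ucz]]].
  apply/hset_opP; exists u, c; split=> //.
  by apply/hset_opP; exists x, b.
- move=> /hset_opP[a [b [Aa Bb abx]]] Cy xyz.
  have : ((a ⊞ b) ⊕ [set y]) z by apply/hset_opP; exists x, y.
  rewrite -haddA => /hset_opP[_ [u [/= -> byu auz]]].
  apply/hset_opP; exists a, u; split=> //.
  by apply/hset_opP; exists b, y.
Qed.

Lemma hset_opACA A B C D : (A ⊕ B) ⊕ (C ⊕ D) = (A ⊕ C) ⊕ (B ⊕ D).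
Proof.
by rewrite -!hset_opA (hset_opA B) (hset_opC B C) -hset_opA.
Qed.

Lemma hoppK x : ⊟ ⊟ x = x.
Proof. by apply/esym/hopp_uniq; rewrite haddC; apply: haddN. Qed.

Lemma hopp_inj x y : ⊟ x = ⊟ y -> x = y.
Proof. by move=> e; rewrite -(hoppK x) e hoppK. Qed.

Lemma hadd0 x : x ⊞ hzero = [set x].
Proof.
have sub z : (x ⊞ hzero) z -> z = x.
  by move=> /hadd_rev /hopp_uniq /hopp_inj.
apply/seteqP; split=> [z /sub //|_ ->].
by have [z xz] := hadd_nonempty x hzero; rewrite -{2}(sub _ xz).
Qed.

Lemma hadd_revr x y z : (x ⊞ y) z -> (z ⊞ ⊟ y) x.
Proof. by rewrite haddC => /hadd_rev. Qed.

Lemma hopp_add x y z : (x ⊞ y) z -> (⊟ x ⊞ ⊟ y) (⊟ z).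
Proof.
by move=> /hadd_rev /hadd_rev /hadd_rev.
Qed.

End HypergroupTheory.

Section HyperfieldTheory.
Variable F : hyperfieldType.
Implicit Types x y z : F.

Lemma hmul_neq0 x y : x <> hzero -> y <> hzero -> x ⊙ y <> hzero.
Proof.
move=> /hmulV[x' xx'] y0 xy0; apply: y0.
by rewrite -(hmul1 y) -xx' (hmulC x) hmulA (hmulC y) -hmulA (hmulC y) xy0 hmul0.
Qed.

Lemma hmulN x y : x ⊙ ⊟ y = ⊟ (x ⊙ y).
Proof.
apply: hopp_uniq; rewrite -hmulDr; exists hzero; last exact: hmul0.
exact: haddN.
Qed.

Lemma hmulNN x y : ⊟ x ⊙ ⊟ y = x ⊙ y.
Proof. by rewrite hmulN hmulC hmulN hoppK hmulC. Qed.

Lemma hmul_add x y z w : (y ⊞ z) w -> (x ⊙ y ⊞ x ⊙ z) (x ⊙ w).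
Proof. by rewrite -hmulDr => yzw; exists w. Qed.

End HyperfieldTheory.

Section ResidueHyperfield.
Variables (F : hyperfieldType) (G : orderedAbGroupType) (v : valuation F G).
Local Notation O := (val_ring v).
Local Notation M := (val_ideal v).
Local Notation cls := (residue_class v).
Implicit Types x y z : F.

Lemma wi_add0 (g : with_infty G) : wi_add g (fin 0%R) = g.
Proof. by case: g => [g|] //=; rewrite addr0. Qed.

Lemma wi_double0 (g : with_infty G) :
  g <> infty -> wi_add g g = fin 0%R -> g = fin 0%R.
Proof.
case: g => [g|] // _ [gg]; congr Some.
apply/eqP; rewrite eq_le; have /orP[g0|g0] := oag_le_total g 0%R.
  by rewrite g0 /=; have := @oag_le_add2l G g _ _ g0; rewrite addr0 gg.
by rewrite g0 andbT; have := @oag_le_add2l G g _ _ g0; rewrite addr0 gg.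
Qed.

Lemma wi_le_addr (g h : with_infty G) :
  (fin 0 <= h)%R -> (g <= wi_add g h)%R.
Proof.
case: g h => [g|] [h|] //= h0; rewrite /Order.le /=.
by have := @oag_le_add2l G g 0%R h h0; rewrite addr0.
Qed.

Lemma val_zero : v hzero = infty. Proof. exact/val_infty. Qed.

Lemma val_one : v hone = fin 0%R.
Proof.
have := val_mul v hone hone; rewrite hmul1.
have : v hone <> infty by move/val_infty/hone_neq0.
case: (v hone) => [g|] // _ [/esym gg]; congr Some.
by apply: (addrI g); rewrite addr0.
Qed.

Lemma val_opp x : v (⊟ x) = v x.
Proof.
have vN1 : v (⊟ hone) = fin 0%R.
  apply: wi_double0; last by rewrite -val_mul hmulNN hmul1 val_one.
  move=> /val_infty N10; apply: (@hone_neq0 F).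
  by rewrite -(hmul1 hone) -hmulNN N10 hmul0.
by rewrite -{1}(hmul1 x) -hmulN val_mul vN1 wi_add0.
Qed.

Lemma val_ring_add x y z : O x -> O y -> (x ⊞ y) z -> O z.
Proof.
move=> Ox Oy /(val_add v); apply: le_trans.
by rewrite /Order.min; case: ifP.
Qed.

Lemma val_ring_mul x y : O x -> O y -> O (x ⊙ y).
Proof. by move=> Ox Oy; rewrite /val_ring /= val_mul; apply: (le_trans Ox); apply: wi_le_addr. Qed.

Lemma val_ring_opp x : O x -> O (⊟ x).
Proof. by rewrite /val_ring /= val_opp. Qed.

Lemma val_ideal_ring x : M x -> O x. Proof. exact: ltW. Qed.

Lemma val_ideal_add x y z : M x -> M y -> (x ⊞ y) z -> M z.
Proof.
move=> Mx My /(val_add v); apply: lt_le_trans.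
by rewrite /Order.min; case: ifP.
Qed.

Lemma val_ideal_opp x : M x -> M (⊟ x).
Proof. by rewrite /val_ideal /= val_opp. Qed.

Lemma val_ideal_mul x y : M x -> O y -> M (x ⊙ y).
Proof. by move=> Mx Oy; rewrite /val_ideal /= val_mul; apply: (lt_le_trans Mx); apply: wi_le_addr. Qed.

Lemma val_ideal0 : M hzero. Proof. by rewrite /val_ideal /= val_zero. Qed.

Lemma residue_relP x y : residue_rel v x y <-> exists2 m, M m & (x ⊞ m) y.
Proof.
split=> [[m [xym Mm]]|[m Mm xmy]].
  exists (⊟ m); first exact: val_ideal_opp.
  by have := hopp_add (hadd_rev xym); rewrite !hoppK haddC.
exists (⊟ m); split; last exact: val_ideal_opp.
by have := hopp_add (hadd_rev xmy); rewrite hoppK haddC.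
Qed.

Lemma residue_classE x : O x -> cls x = [set x] ⊕ M.
Proof.
move=> Ox; apply/seteqP; split=> y.
  case=> _ /residue_relP[m Mm xmy].
  by apply/hset_opP; exists x, m.
move=> /hset_opP[_ [m [/= -> Mm xmy]]]; split; last by apply/residue_relP; exists m.
exact: val_ring_add Ox (val_ideal_ring Mm) xmy.
Qed.

Lemma residue_rel_refl x : residue_rel v x x.
Proof. by exists hzero; split; [exact: haddN|exact: val_ideal0]. Qed.

Lemma residue_rel_sym x y : residue_rel v x y -> residue_rel v y x.
Proof.
case=> m [xym Mm]; exists (⊟ m); split; last exact: val_ideal_opp.
by have := hopp_add xym; rewrite hoppK haddC.
Qed.

Lemma residue_rel_trans x y z :
  residue_rel v x y -> residue_rel v y z -> residue_rel v x z.
Proof.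
move=> /residue_relP[m Mm xmy] /residue_relP[n Mn ynz]; apply/residue_relP.
have : ((x ⊞ m) ⊕ [set n]) z by apply/hset_opP; exists y, n.
rewrite -haddA => /hset_opP[_ [u [/= -> mnu xuz]]].
by exists u => //; apply: val_ideal_add mnu.
Qed.

Lemma residue_class_self x : O x -> cls x x.
Proof. by move=> Ox; split => //; apply: residue_rel_refl. Qed.

Lemma residue_class_eq x y : O x -> O y -> residue_rel v x y <-> cls x = cls y.
Proof.
move=> Ox Oy; split=> [xy|e]; last first.
  by have := residue_class_self Oy; rewrite -e => -[].
apply/seteqP; split=> z [Oz rz]; split => //.
  exact: residue_rel_trans (residue_rel_sym xy) rz.
exact: residue_rel_trans xy rz.
Qed.

Lemma residue_class_mem x y : O x -> cls x y -> cls y = cls x.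
Proof. by move=> Ox [Oy xy]; apply/esym/residue_class_eq. Qed.

Lemma residue_add_lift x y x' y' z' : cls x x' -> cls y y' ->
  (x' ⊞ y') z' -> exists2 z, (x ⊞ y) z & residue_rel v z z'.
Proof.
move=> [_ /residue_relP[m Mm xmx]] [_ /residue_relP[n Mn yny]] xyz.
have : ((x ⊞ m) ⊕ (y ⊞ n)) z' by apply/hset_opP; exists x', y'.
rewrite -(hset_op11 x) -(hset_op11 y) hset_opACA !hset_op11.
case/hset_opP=> z [u [xyzz mnu zuz]]; exists z => //.
by apply/residue_relP; exists u => //; apply: val_ideal_add mnu.
Qed.

Lemma residue_mul_rel x y x' y' : O x -> O y -> cls x x' -> cls y y' ->
  residue_rel v (x ⊙ y) (x' ⊙ y').
Proof.
move=> Ox Oy [Ox' [m [xm Mm]]] [Oy' [n [yn Mn]]].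
apply: (@residue_rel_trans _ (x ⊙ y')).
  exists (x ⊙ n); split; last by rewrite hmulC; apply: val_ideal_mul.
  by rewrite -hmulN; apply: hmul_add.
exists (y' ⊙ m); split; last by rewrite hmulC; apply: val_ideal_mul.
by rewrite ![_ ⊙ y']hmulC -hmulN; apply: hmul_add.
Qed.

Fact residue_in_proof x : O x -> exists2 y, O y & cls x = cls y.
Proof. by move=> Ox; exists x. Qed.

Definition residue_in x (Ox : O x) : residue v :=
  exist _ (cls x) (residue_in_proof Ox).

Lemma residueP (A : residue v) : exists x (Ox : O x), A = residue_in Ox.
Proof.
case: A => A [x Ox e]; exists x, Ox; subst A.
by congr exist; apply: Prop_irrelevance.
Qed.

Lemma residue_eqP (A B : residue v) : sval A = sval B -> A = B.
Proof. by move: A B => [A pA] [B pB] /= e; subst B; congr exist; apply: Prop_irrelevance. Qed.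

Definition res_zero : residue v := residue_in (val_ideal_ring val_ideal0).

Fact val_ring1 : O hone. Proof. by rewrite /val_ring /= val_one. Qed.
Definition res_one : residue v := residue_in val_ring1.

Definition residue_repr (A : residue v) : F := s2val (cid2 (svalP A)).

Lemma residue_repr_ring A : O (residue_repr A).
Proof. exact: (s2valP (cid2 (svalP A))). Qed.

Lemma residue_reprE A : sval A = cls (residue_repr A).
Proof. exact: (s2valP' (cid2 (svalP A))). Qed.

Lemma residue_repr_in x (Ox : O x) : cls x (residue_repr (residue_in Ox)).
Proof.
have -> : cls x = cls (residue_repr (residue_in Ox)) by rewrite -residue_reprE.
exact/residue_class_self/residue_repr_ring.
Qed.

(* The operations are computed on chosen representatives; [res_addE],
   [res_oppE] and [res_mulE] show that any representatives will do. *)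
Definition res_add (A B : residue v) : set (residue v) :=
  [set C | exists2 z, (residue_repr A ⊞ residue_repr B) z & sval C = cls z].

Definition res_opp (A : residue v) : residue v :=
  residue_in (val_ring_opp (residue_repr_ring A)).

Definition res_mul (A B : residue v) : residue v :=
  residue_in (val_ring_mul (residue_repr_ring A) (residue_repr_ring B)).

Lemma residue_in_eq x y (Ox : O x) (Oy : O y) :
  residue_rel v x y <-> residue_in Ox = residue_in Oy.
Proof.
split=> [xy|/(congr1 sval) /= e]; last exact/residue_class_eq.
exact/residue_eqP/residue_class_eq.
Qed.

Lemma res_addE x y (Ox : O x) (Oy : O y) :
  res_add (residue_in Ox) (residue_in Oy) =
  [set C | exists2 z, (x ⊞ y) z & sval C = cls z].
Proof.
have Rx := residue_repr_in Ox; have Ry := residue_repr_in Oy.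
have Rx' := residue_repr_ring (residue_in Ox).
have Ry' := residue_repr_ring (residue_in Oy).
have Sx : cls (residue_repr (residue_in Ox)) x.
  by rewrite (residue_class_mem Ox Rx); apply: residue_class_self.
have Sy : cls (residue_repr (residue_in Oy)) y.
  by rewrite (residue_class_mem Oy Ry); apply: residue_class_self.
apply/seteqP; split=> C [z xyz Cz].
  have [w xyw wz] := residue_add_lift Rx Ry xyz; exists w => //; rewrite Cz.
  apply/esym/residue_class_eq => //; last exact: val_ring_add xyz.
  exact: val_ring_add xyw.
have [w xyw wz] := residue_add_lift Sx Sy xyz; exists w => //; rewrite Cz.
apply/esym/residue_class_eq => //; last exact: val_ring_add xyz.
exact: val_ring_add xyw.
Qed.

Lemma res_add_in x y z (Ox : O x) (Oy : O y) (Oz : O z) :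
  (x ⊞ y) z -> res_add (residue_in Ox) (residue_in Oy) (residue_in Oz).
Proof. by move=> xyz; rewrite res_addE; exists z. Qed.

Lemma res_addP x y (Ox : O x) (Oy : O y) C :
  res_add (residue_in Ox) (residue_in Oy) C ->
  exists z (Oz : O z), (x ⊞ y) z /\ C = residue_in Oz.
Proof.
rewrite res_addE => -[z xyz Cz]; exists z, (val_ring_add Ox Oy xyz).
by split=> //; apply: residue_eqP.
Qed.

Lemma res_oppE x (Ox : O x) :
  res_opp (residue_in Ox) = residue_in (val_ring_opp Ox).
Proof.
apply/residue_in_eq/residue_rel_sym; have [_ [m [xm Mm]]] := residue_repr_in Ox.
by exists (⊟ m); split; [exact: hopp_add|exact: val_ideal_opp].
Qed.

Lemma res_mulE x y (Ox : O x) (Oy : O y) :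
  res_mul (residue_in Ox) (residue_in Oy) = residue_in (val_ring_mul Ox Oy).
Proof.
apply/residue_in_eq/residue_rel_sym.
by apply: residue_mul_rel => //; apply: residue_repr_in.
Qed.

Fact res_add_nonempty A B : res_add A B !=set0.
Proof.
have [x [Ox ->]] := residueP A; have [y [Oy ->]] := residueP B.
have [z xyz] := hadd_nonempty x y.
by exists (residue_in (val_ring_add Ox Oy xyz)); apply: res_add_in.
Qed.

Fact res_addC A B : res_add A B = res_add B A.
Proof.
have [x [Ox ->]] := residueP A; have [y [Oy ->]] := residueP B.
by rewrite !res_addE haddC.
Qed.

Fact res_addA_sub A B C :
  hset_op res_add [set A] (res_add B C) `<=`
  hset_op res_add (res_add A B) [set C].
Proof.
have [x [Ox ->]] := residueP A; have [y [Oy ->]] := residueP B.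
have [z [Oz ->]] := residueP C.
move=> D [_ /= -> [E /res_addP[u [Ou [yzu ->]]] /res_addP[w [Ow [xuw ->]]]]].
have : ([set x] ⊕ (y ⊞ z)) w by apply/hset_opP; exists x, u.
rewrite haddA => /hset_opP[t [_ [xyt /= -> tzw]]].
exists (residue_in (val_ring_add Ox Oy xyt)); first exact: res_add_in.
by exists (residue_in Oz) => //; apply: res_add_in.
Qed.

Fact res_addA A B C :
  hset_op res_add [set A] (res_add B C) =
  hset_op res_add (res_add A B) [set C].
Proof.
have opC X Y : hset_op res_add X Y = hset_op res_add Y X.
  by apply/seteqP; split=> D [a Xa [b Yb abD]]; exists b => //; exists a => //;
     rewrite res_addC.
apply/seteqP; split; first exact: res_addA_sub.
rewrite opC (res_addC A B) [X in _ `<=` X]opC (res_addC B C).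
exact: res_addA_sub.
Qed.

Fact res_addN A : res_add A (res_opp A) res_zero.
Proof.
have [x [Ox ->]] := residueP A; rewrite res_oppE.
exact/res_add_in/haddN.
Qed.

Fact res_opp_uniq A B : res_add A B res_zero -> B = res_opp A.
Proof.
have [x [Ox ->]] := residueP A; have [y [Oy ->]] := residueP B.
rewrite res_oppE => /res_addP[z [Oz [xyz /residue_in_eq]]].
rewrite residue_relP => -[m Mm].
have -> : hzero ⊞ m = [set m] by rewrite haddC hadd0.
move=> /= zm; subst m.
apply/residue_in_eq; exists z; split => //.
by rewrite hoppK haddC.
Qed.

Fact res_add_rev A B C : res_add A B C -> res_add C (res_opp A) B.
Proof.
have [x [Ox ->]] := residueP A; have [y [Oy ->]] := residueP B.
move=> /res_addP[z [Oz [xyz ->]]]; rewrite res_oppE.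
exact/res_add_in/hadd_rev.
Qed.

HB.instance Definition _ := isCanonicalHypergroup.Build (residue v)
  res_add_nonempty res_addA res_addC res_addN res_opp_uniq res_add_rev.

Fact res_mulA A B C : res_mul A (res_mul B C) = res_mul (res_mul A B) C.
Proof.
have [x [Ox ->]] := residueP A; have [y [Oy ->]] := residueP B.
have [z [Oz ->]] := residueP C.
by rewrite !res_mulE; apply: residue_eqP; rewrite /= hmulA.
Qed.

Fact res_mulC A B : res_mul A B = res_mul B A.
Proof.
have [x [Ox ->]] := residueP A; have [y [Oy ->]] := residueP B.
by rewrite !res_mulE; apply: residue_eqP; rewrite /= hmulC.
Qed.

Fact res_mul0 A : res_mul A hzero = hzero.
Proof.
have [x [Ox ->]] := residueP A.
by rewrite res_mulE; apply: residue_eqP; rewrite /= hmul0.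
Qed.

Fact res_mulDr A B C :
  [set res_mul A D | D in B ⊞ C] = res_mul A B ⊞ res_mul A C.
Proof.
have [x [Ox ->]] := residueP A; have [y [Oy ->]] := residueP B.
have [z [Oz ->]] := residueP C; rewrite !res_mulE.
apply/seteqP; split=> D.
  move=> [_ /res_addP[w [Ow [yzw ->]]] <-]; rewrite res_mulE.
  exact/res_add_in/hmul_add.
move=> /res_addP[w [Ow []]]; rewrite -hmulDr => -[u yzu xuw ->].
exists (residue_in (val_ring_add Oy Oz yzu)); first exact: res_add_in.
by rewrite res_mulE; apply: residue_eqP; rewrite /= xuw.
Qed.

HB.instance Definition _ := CanonicalHypergroup_isHyperring.Build (residue v)
  res_mulA res_mulC res_mul0 res_mulDr.

Fact res_mul1 A : res_mul A res_one = A.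
Proof.
have [x [Ox ->]] := residueP A.
by rewrite res_mulE; apply: residue_eqP; rewrite /= hmul1.
Qed.

Lemma residue_in0 x (Ox : O x) : residue_in Ox = hzero <-> M x.
Proof.
rewrite -[hzero]/res_zero -residue_in_eq; split=> [/residue_rel_sym|Mx].
  rewrite residue_relP => -[m Mm]; rewrite haddC hadd0 /= => xm.
  by rewrite xm.
apply/residue_rel_sym/residue_relP; exists x => //.
by rewrite haddC hadd0.
Qed.

Fact res_one_neq0 : res_one <> hzero.
Proof. by move=> /residue_in0; rewrite /val_ideal /= val_one ltxx. Qed.

Fact res_mulV A : A <> hzero -> exists B, res_mul A B = res_one.
Proof.
have [x [Ox ->]] := residueP A => /residue_in0 Mx.
have x0 : x <> hzero by move=> x0; apply: Mx; rewrite x0; apply: val_ideal0.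
have [y xy] := hmulV x x0.
have vx : v x = fin 0%R.
  by apply/le_anti; rewrite Ox andbT leNgt; apply/negP.
have vy : v y = fin 0%R.
  have := val_mul v x y; rewrite xy val_one vx => ->.
  by case: (v y) => //= g; rewrite add0r.
have Oy : O y by rewrite /val_ring /= vy.
by exists (residue_in Oy); rewrite res_mulE; apply: residue_eqP; rewrite /= xy.
Qed.

HB.instance Definition _ := Hyperring_isHyperfield.Build (residue v)
  res_mul1 res_one_neq0 res_mulV.

End ResidueHyperfield.

Definition residue_set (F : hyperfieldType) (G : orderedAbGroupType)
    (v : valuation F G) (P : set F) : set (residue v) :=
  [set C | exists2 a, (P `&` val_units v) a & sval C = residue_class v a].
Arguments residue_set {F G} v P.

(* Main.v *)
Require Import Defs.
From mathcomp Require Import all_boot all_order all_algebra.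
From mathcomp Require Import boolp classical_sets.

Import Order.TTheory.

Local Open Scope classical_set_scope.
Local Open Scope hyper_scope.

(** The pivot is condition (iii), [1 + M ⊆ P].  It says that a summand of
    strictly larger value never changes a sign: if [v a < v b], then every
    element of [a + b] is [a] times an element of [1 + M], hence is positive
    when [a] is ([one_plus_ideal_absorb]).

    From this, the sign of a unit depends only on its residue class, which makes
    the positive residue classes an ordering ([one_plus_ideal_residue]); and when
    [v a < v b], the elements of [b + a] have the sign of [a] and those of
    [b - a] the sign of [-a], so the two sets cannot both meet [P], which is (iv)
    ([one_plus_ideal_compatible]).  Conversely, an ordering of the residue
    hyperfield forces (iii), since elements of [1 + M] have the residue class of
    the positive element [1] ([residue_one_plus_ideal]).

    For (i) => (iii), a non-positive element of [1 + m] with [v m > 0] would make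
    [-m^-1] an element of [A(P)] of negative value
    ([bounded_one_plus_ideal]).  For (iv) => (i), the elements of [I_n] are
    positive of value at least [0].  Membership in [A(P)] provides two possibly
    different elements [y], [y'] of [I_n] such that [y + a] and [y' - a] meet
    [P], but one single [b] in [I_n] serves both purposes: [y'] if [a] is
    positive and [y] if [-a] is ([compatible_bounded]). *)

Set Implicit Arguments.
Unset Strict Implicit.

Section Ordering.
Variables (F : hyperfieldType) (P : set F).
Hypothesis hP : is_ordering P.
Implicit Types x y z : F.

Lemma ordering_neq0 x : P x -> x <> hzero.
Proof.
move=> Px.
by have : (P `|` [set ⊟ x | x in P]) x by [left]; rewrite (ordering_cover hP).
Qed.

Lemma ordering_total x : x <> hzero -> P x \/ P (⊟ x).
Proof.
move=> x0; have : [set x | x <> hzero] x by [].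
rewrite -(ordering_cover hP) => -[|[y Py <-]]; first by left.
by right; rewrite hoppK.
Qed.

Lemma ordering_asym x : P x -> ~ P (⊟ x).
Proof.
move=> Px PNx; suff : (P `&` [set ⊟ x | x in P]) x by rewrite (ordering_disj hP).
by split=> //; exists (⊟ x) => //; rewrite hoppK.
Qed.

Lemma ordering_addP x y z : P x -> P y -> (x ⊞ y) z -> P z.
Proof.
by move=> Px Py xyz; apply: (ordering_add hP); apply/hset_opP; exists x, y.
Qed.

Lemma ordering_mulP x y : P x -> P y -> P (x ⊙ y).
Proof. by move=> Px Py; apply: (ordering_mul hP); exists x => //; exists y. Qed.

Lemma ordering_one : P hone.
Proof.
case: (ordering_total (@hone_neq0 F)) => // PN1.
by rewrite -(hmul1 hone) -hmulNN; apply: ordering_mulP.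
Qed.

Lemma ordering_inv x y : P x -> x ⊙ y = hone -> P y.
Proof.
move=> Px xy1.
have y0 : y <> hzero.
  by move=> y0; apply: (@hone_neq0 F); rewrite -xy1 y0 hmul0.
case: (ordering_total y0) => // PNy.
case: (ordering_asym ordering_one).
by rewrite -xy1 -hmulN; apply: ordering_mulP.
Qed.

Lemma hone_sum_ordering n : hone_sum F n `<=` P.
Proof.
rewrite /hone_sum; elim: n.-1 => [|k IHk] /= y; first by move=> ->; exact: ordering_one.
move=> /hset_opP[x [_ [/IHk Px /= -> ]]].
exact: (ordering_addP Px ordering_one).
Qed.

End Ordering.

Section Value.
Variables (F : hyperfieldType) (G : orderedAbGroupType) (v : valuation F G).
Implicit Types x y z a b : F.

Lemma wi_ge_addr (g h : with_infty G) :
  (g <= fin 0)%R -> (wi_add h g <= h)%R.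
Proof.
case: g h => [g|] [h|] //= g0; rewrite /Order.le /=.
by have := @oag_le_add2l G h g 0%R g0; rewrite GRing.addr0.
Qed.

Lemma val_lt_neq0 a b : (v a < v b)%R -> a <> hzero.
Proof.
move=> ab a0; move: ab; rewrite a0 val_zero ltNge.
by case: (v b).
Qed.

Lemma hone_sum_val_ring n : hone_sum F n `<=` val_ring v.
Proof.
rewrite /hone_sum; elim: n.-1 => [|k IHk] /= y.
  by move=> ->; exact: val_ring1.
move=> /hset_opP[x [_ [/IHk Ox /= -> ]]].
exact: val_ring_add Ox (val_ring1 v).
Qed.

Lemma val_unitP x : val_ring v x -> ~ val_ideal v x -> val_units v x.
Proof.
move=> Ox Mx; apply/le_anti; rewrite Ox andbT.
by rewrite leNgt; apply/negP.
Qed.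

Lemma val_unit_ring x : val_units v x -> val_ring v x.
Proof. by rewrite /val_units /val_ring /= => ->. Qed.

Lemma val_unit_not_ideal x : val_units v x -> ~ val_ideal v x.
Proof.
by rewrite /val_units /val_ideal /= => ->; rewrite ltxx.
Qed.

(** Factoring out the summand of least value: [a + b = a (1 + a^-1 b)]. *)
Lemma hadd_dominant a b c : (v a < v b)%R -> (a ⊞ b) c ->
  exists2 u, ([set hone] ⊕ val_ideal v) u & c = a ⊙ u.
Proof.
move=> ab; have [a' aa'] := hmulV a (val_lt_neq0 ab).
have aK : a ⊙ (a' ⊙ b) = b by rewrite hmulA aa' hmulC hmul1.
rewrite -{1}(hmul1 a) -aK -hmulDr => -[u u1 <-]; exists u => //.
apply/hset_opP; exists hone, (a' ⊙ b); split=> //.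
rewrite /val_ideal /= ltNge; apply/negP => le0.
move: ab; rewrite -{1}aK val_mul ltNge.
by rewrite wi_ge_addr.
Qed.

Lemma residue_setP (P : set F) (C : residue v) :
  residue_set v P C <->
  exists x (Ox : val_ring v x), [/\ P x, val_units v x & C = residue_in Ox].
Proof.
split=> [[x [Px Ux] Cx]|[x [Ox [Px Ux ->]]]]; last by exists x.
exists x, (val_unit_ring Ux); split=> //; exact: residue_eqP.
Qed.

Section Compatibility.
Variable P : set F.
Hypothesis hP : is_ordering P.

(** If [x ∈ 1 + m] were negative, then [-m ∈ 1 - x] would be positive, and so
    would be [a = -m^-1]; now [a (-x) ∈ 1 - a] is positive as well, so that [a]
    is bounded by [I_1 = 1], in spite of its negative value. *)
Lemma bounded_one_plus_ideal :
  bounded_elements P `<=` val_ring v -> [set hone] ⊕ val_ideal v `<=` P.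
Proof.
move=> AO x /hset_opP[_ [m [/= -> Mm mx]]].
have x0 : x <> hzero.
  move=> x0; move: mx; rewrite x0 => /hopp_uniq m1; move: Mm.
  by rewrite m1 /val_ideal /= val_opp val_one ltxx.
case: (ordering_total hP x0) => // PNx.
have PNm : P (⊟ m).
  have := hopp_add (hadd_rev mx); rewrite hoppK haddC.
  exact: (ordering_addP hP (ordering_one hP) PNx).
have [a ma] := hmulV _ (ordering_neq0 hP PNm).
have Pa := ordering_inv hP PNm ma.
have Oa : val_ring v a.
  apply: AO; exists 1; rewrite /hone_sum /= !hset_op11; split=> //.
    have [y y1] := hadd_nonempty hone a; exists y; split=> //.
    exact: (ordering_addP hP (ordering_one hP) Pa y1).
  exists (a ⊙ ⊟ x); split; last exact: ordering_mulP.
  rewrite haddC -ma (hmulC (⊟ m)) -{1}(hmul1 a) -hmulN.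
  exact/hmul_add/hopp_add.
have := val_ideal_mul (val_ideal_opp Mm) Oa.
by rewrite ma => /(val_unit_not_ideal (val_one v)).
Qed.

Lemma one_plus_ideal_absorb a b c : [set hone] ⊕ val_ideal v `<=` P ->
  P a -> (v a < v b)%R -> (a ⊞ b) c -> P c.
Proof.
move=> MP Pa ab /(hadd_dominant ab)[u /MP Pu ->].
exact: ordering_mulP.
Qed.

Lemma one_plus_ideal_residue :
  [set hone] ⊕ val_ideal v `<=` P -> is_ordering (residue_set v P).
Proof.
move=> MP.
have lift x y : P x -> val_units v x -> residue_rel v x y -> P y.
  move=> Px Ux /residue_relP[m Mm]; apply: one_plus_ideal_absorb => //.
  by rewrite Ux.
split.
- move=> C /hset_opP[A [B [/residue_setP[x [Ox [Px Ux ->]]]]]].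
  move=> /residue_setP[y [Oy [Py Uy ->]]] /res_addP[z [Oz [xyz ->]]].
  apply/residue_setP; exists z, Oz; split=> //.
    exact: (ordering_addP hP Px Py xyz).
  (* If [x + y] contained an element of the ideal, then [-y] would be congruent
     to the positive unit [x]. *)
  apply: val_unitP => // Mz; apply: (ordering_asym hP Py).
  apply: (lift x) => //; apply/residue_relP; exists (⊟ z).
    exact: val_ideal_opp.
  exact: (hadd_rev (hadd_revr xyz)).
- move=> _ [A /residue_setP[x [Ox [Px Ux ->]]]
    [B /residue_setP[y [Oy [Py Uy ->]]] <-]].
  apply/residue_setP; exists (x ⊙ y), (val_ring_mul Ox Oy).
  split; first exact: ordering_mulP.
    by rewrite /val_units /= val_mul Ux Uy wi_add0.
  exact: res_mulE.
- apply/seteqP; split=> // C [/residue_setP[x [Ox [Px Ux ->]]]].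
  move=> [B /residue_setP[y [Oy [Py Uy ->]]]].
  rewrite -[⊟ _]/(res_opp _) res_oppE => /residue_in_eq/residue_rel_sym xNy.
  exact: (ordering_asym hP Py (lift _ _ Px Ux xNy)).
- apply/seteqP; split=> C.
    move=> [/residue_setP[x [Ox [_ Ux ->]]]|].
      by move=> /residue_in0; apply: val_unit_not_ideal.
    move=> [_ /residue_setP[x [Ox [_ Ux ->]]] <-].
    rewrite -[⊟ _]/(res_opp _) res_oppE => /residue_in0.
    by apply: val_unit_not_ideal; rewrite /val_units /= val_opp.
  have [x [Ox ->]] := residueP C => /= x0.
  have Mx : ~ val_ideal v x by move=> Mx; apply/x0/residue_in0.
  have Ux := val_unitP Ox Mx.
  have x_neq0 : x <> hzero by move=> e; apply: Mx; rewrite e; apply: val_ideal0.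
  case: (ordering_total hP x_neq0) => [Px|PNx]; [left|right].
    by apply/residue_setP; exists x, Ox.
  exists (residue_in (val_ring_opp Ox)).
    apply/residue_setP; exists (⊟ x), (val_ring_opp Ox); split=> //.
    by rewrite /val_units /= val_opp.
  by rewrite -[⊟ _]/(res_opp _) res_oppE; apply: residue_eqP; rewrite /= hoppK.
Qed.

Lemma residue_one_plus_ideal :
  is_ordering (residue_set v P) -> [set hone] ⊕ val_ideal v `<=` P.
Proof.
move=> hR x /hset_opP[_ [m [/= -> Mm mx]]].
have Ox : val_ring v x.
  exact: val_ring_add (val_ring1 v) (val_ideal_ring Mm) mx.
have xE : residue_in Ox = hone.
  by apply/esym/residue_in_eq/residue_relP; exists m.
have Mx : ~ val_ideal v x by move/(residue_in0 Ox); rewrite xE; apply: hone_neq0.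
have x0 : x <> hzero by move=> e; apply: Mx; rewrite e; apply: val_ideal0.
case: (ordering_total hP x0) => // PNx.
case: (ordering_asym hR (ordering_one hR)).
rewrite -xE -[⊟ _]/(res_opp _) res_oppE; apply/residue_setP.
exists (⊟ x), (val_ring_opp Ox); split=> //.
by rewrite /val_units /= val_opp; apply: val_unitP.
Qed.

Lemma one_plus_ideal_compatible : [set hone] ⊕ val_ideal v `<=` P ->
  forall a b, (b ⊞ a) `&` P !=set0 -> (b ⊞ ⊟ a) `&` P !=set0 -> (v b <= v a)%R.
Proof.
move=> MP a b [p [bap Pp]] [q [baq Pq]].
rewrite leNgt; apply/negP => ab.
case: (ordering_total hP (val_lt_neq0 ab)) => [Pa|PNa].
  apply: (ordering_asym hP Pq).
  apply: (@one_plus_ideal_absorb a (⊟ b)) => //; first by rewrite val_opp.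
  by have := hopp_add baq; rewrite hoppK haddC.
apply: (ordering_asym hP Pp).
apply: (@one_plus_ideal_absorb (⊟ a) (⊟ b)) => //; first by rewrite !val_opp.
by rewrite haddC; apply: hopp_add.
Qed.

Lemma compatible_bounded :
  (forall a b, (b ⊞ a) `&` P !=set0 -> (b ⊞ ⊟ a) `&` P !=set0 ->
    (v b <= v a)%R) ->
  bounded_elements P `<=` val_ring v.
Proof.
move=> compat a [n [_ [p [/hset_opP[y [_ [ny /= -> yap]]] Pp]]]].
move=> [q [/hset_opP[y' [_ [ny' /= -> yaq]]] Pq]].
have addP x z : P x -> P z -> (x ⊞ z) `&` P !=set0.
  move=> Px Pz; have [t xzt] := hadd_nonempty x z; exists t; split=> //.
  exact: (ordering_addP hP Px Pz xzt).
have nP := @hone_sum_ordering _ _ hP n; have nO := @hone_sum_val_ring n.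
have [a0|a0] := pselect (a = hzero).
  by rewrite a0; exact/val_ideal_ring/val_ideal0.
case: (ordering_total hP a0) => [Pa|PNa].
  apply: (le_trans (nO _ ny')); apply: compat.
    exact: addP (nP _ ny') Pa.
  by exists q.
apply: (le_trans (nO _ ny)); apply: compat.
  by exists p.
exact: addP (nP _ ny) PNa.
Qed.

End Compatibility.
End Value.

Unset Implicit Arguments.

Theorem proposition5p7 (F : hyperfieldType) (G : orderedAbGroupType)
    (v : valuation F G) (P : set F) (hP : is_ordering P) :
  [<-> bounded_elements P `<=` val_ring v;
       is_ordering (residue_set v P);
       [set hone] ⊕ val_ideal v `<=` P;
       forall a b : F,
         (b ⊞ a) `&` P !=set0 -> (b ⊞ ⊟ a) `&` P !=set0 -> (v b <= v a)%R].
Proof.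
tfae.
- by move=> AO; apply: one_plus_ideal_residue => //; apply: bounded_one_plus_ideal.
- exact: residue_one_plus_ideal.
- exact: one_plus_ideal_compatible.
- exact: compatible_bounded.
Qed.
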